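(* Let $K$ be a field of characteristic zero and, for $a\in K\setminus\{-1,0,1/2,1,2\}$, let $Q(a)$ be the quartic surface in $\mathbb{P}^3_K$ defined by the vanishing of the polynomial $$\begin{aligned} & 2ax^3y+ 4ax^2y^2+ 2axy^3 -(2a - 1)(a - 2)x^3z -(5a^2 - 17a + 5)x^2yz\\ & -3(a^2 - 4a + 1)xy^2z + ay^3z -3(2a - 1)(a - 2)x^2z^2 -(7a^2 - 19a + 7)xyz^2\\ & + 2ay^2z^2 -2(2a - 1)(a - 2)xz^3 +ayz^3 -2atx^2y-2atxy^2+ 2(2a - 1)(a - 2)tx^2z\\ & + 4(a^2 - 3a + 1)txyz -2aty^2z+ 2(2a - 1)(a - 2)txz^2 -2atyz^2 . \end{aligned}$$ Let $a,b\in K\setminus\{-1,0,1/2,1,2\}$. Then $Q(a)$ and $Q(b)$ are projectively equivalent if and only if $a$ has one of the following values: $$b,\quad \frac1b,\quad \frac{1}{1-b},\quad \frac{b}{b-1},\quad 1-b,\quad \frac{b-1}{b}.$$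
   Context: Homogeneous coordinates on $\mathbb{P}^3_K$ are $(x,y,z,t)$. Two surfaces in $\mathbb{P}^3_K$ are projectively equivalent if some element of $\mathrm{PGL}(4,K)$ maps one to the other (equivalently, their defining polynomials agree up to an invertible linear change of variables over $K$ and a nonzero scalar factor). *)

(* Defs.v *)
From HB Require Import structures.
From mathcomp Require Import all_boot all_order all_algebra.
From mathcomp Require Export mpoly.

Set Implicit Arguments.
Unset Strict Implicit.
Unset Printing Implicit Defensive.

Import GRing.Theory.
Local Open Scope ring_scope.

Definition linear_change (K : fieldType) (n : nat) (M : 'M[K]_n)
    (f : {mpoly K[n]}) : {mpoly K[n]} :=
  f \mPo [tuple \sum_(j < n) M i j *: 'X_j | i < n].

(* A hypersurface of P^(n-1) over K is given by its defining form, which is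
   determined up to a nonzero scalar.  Points with coordinates in K would not
   determine it, since K need not be algebraically closed.  An element of
   PGL(n, K) is represented by an invertible matrix over K. *)
Definition projectively_equivalent (K : fieldType) (n : nat)
    (f g : {mpoly K[n]}) : Prop :=
  exists (M : 'M[K]_n) (c : K),
    [/\ M \in unitmx, c != 0 & linear_change M f = c *: g].

Definition quartic (K : fieldType) (a : K) : {mpoly K[4]} :=
  let x : {mpoly K[4]} := 'X_(@Ordinal 4 0 isT) in
  let y : {mpoly K[4]} := 'X_(@Ordinal 4 1 isT) in
  let z : {mpoly K[4]} := 'X_(@Ordinal 4 2 isT) in
  let t : {mpoly K[4]} := 'X_(@Ordinal 4 3 isT) in
    (2 * a) *: (x ^+ 3 * y)
  + (4 * a) *: (x ^+ 2 * y ^+ 2)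
  + (2 * a) *: (x * y ^+ 3)
  - ((2 * a - 1) * (a - 2)) *: (x ^+ 3 * z)
  - (5 * a ^+ 2 - 17 * a + 5) *: (x ^+ 2 * y * z)
  - (3 * (a ^+ 2 - 4 * a + 1)) *: (x * y ^+ 2 * z)
  + a *: (y ^+ 3 * z)
  - (3 * (2 * a - 1) * (a - 2)) *: (x ^+ 2 * z ^+ 2)
  - (7 * a ^+ 2 - 19 * a + 7) *: (x * y * z ^+ 2)
  + (2 * a) *: (y ^+ 2 * z ^+ 2)
  - (2 * (2 * a - 1) * (a - 2)) *: (x * z ^+ 3)
  + a *: (y * z ^+ 3)
  - (2 * a) *: (t * x ^+ 2 * y)
  - (2 * a) *: (t * x * y ^+ 2)
  + (2 * (2 * a - 1) * (a - 2)) *: (t * x ^+ 2 * z)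
  + (4 * (a ^+ 2 - 3 * a + 1)) *: (t * x * y * z)
  - (2 * a) *: (t * y ^+ 2 * z)
  + (2 * (2 * a - 1) * (a - 2)) *: (t * x * z ^+ 2)
  - (2 * a) *: (t * y * z ^+ 2).

(* Main.v *)
Require Import Defs.
From HB Require Import structures.
From mathcomp Require Import all_boot all_order all_algebra.
From mathcomp Require Import ring.

Set Implicit Arguments.
Unset Strict Implicit.
Unset Printing Implicit Defensive.

Import GRing.Theory.
Local Open Scope ring_scope.

(** The polynomial has degree 1 in t, so Q(a) has a triple point, the apex
    (0:0:0:1).  The tangent cone at the apex is the cone over a plane cubic E,
    and the lines of Q(a) through the apex give twelve points of E.

    Normal form.  Three of the twelve points are collinear flexes of E.  Let x,
    y, z now denote suitable multiples of the tangents at these flexes, and s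
    the line that joins them, so that x + y + z = w s for a scalar w.  Since E
    has triple contact with each tangent at its flex, it is given by
    xyz = k s^3.  The polar conic of a flex splits into the tangent and the
    harmonic polar; the harmonic polars are y = z, z = x, x = y, and they cut
    out the other nine points.  Hence, with a new t, Q(a) becomes
      t (xyz - k s^3) + s (y - z)(z - x)(x - y) = 0
    with w = 2 (a^2 - a + 1) and k = 2 a^2 (a - 1)^2 (linear_change_normal).
    Here w^3 / k = 4 (a^2 - a + 1)^3 / (a^2 (a - 1)^2) is a multiple of the
    j-invariant of the Legendre curve with parameter a, whose fibres consist of
    the six values of the theorem.

    If part.  Both w and k are unchanged by a -> 1 - a, and the polynomial of
    Q(1/a) is a^-2 times that of Q(a); these two substitutions generate the six
    values (equivalent_six_values).

    Only if part.  A projective equivalence of two normal forms preserves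
    w^3 / k (transport_invariant).  It preserves the triple point, because the
    cone is smooth away from its vertex (singular_cone).  So it carries the
    plane cubic to the plane cubic and the twelve points to the twelve points.
    The flexes among these are exactly the three with s = 0: a flex on a
    harmonic polar lies on the corresponding tangent (flex_on_line_locus).  So
    the equivalence permutes the tangents x, y, z up to factors and preserves s
    up to a factor; comparing first the relation x + y + z = w s and then the
    equation xyz = k s^3 gives the invariant.

    The only if part works with polynomial functions on K^4.  Flexes are
    described by second differences, which makes their invariance under linear
    maps immediate. *)

(** * Projective equivalence is an equivalence relation *)

Section Equivalence.
Variables (K : fieldType) (n : nat).
Implicit Types (M N : 'M[K]_n) (f g h : {mpoly K[n]}).

Lemma linear_changeM M N f :
  linear_change N (linear_change M f) = linear_change (M *m N) f.
Proof.
rewrite /linear_change [f \mPo _]comp_mpolyEX [RHS]comp_mpolyEX raddf_sum /=.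
apply: eq_bigr => m _; rewrite comp_mpolyZ !comp_mpolyX rmorph_prod /=.
congr (_ *: _); apply: eq_bigr => i _; rewrite rmorphXn /= !tnth_mktuple.
congr (_ ^+ _); rewrite raddf_sum /=.
under eq_bigr => j _ do
  rewrite comp_mpolyZ comp_mpolyXU -tnth_nth tnth_mktuple scaler_sumr.
rewrite exchange_big /=; apply: eq_bigr => k _; rewrite mxE scaler_suml.
by apply: eq_bigr => j _; rewrite scalerA.
Qed.

Lemma linear_change1 f : linear_change 1%:M f = f.
Proof.
rewrite /linear_change -[RHS]comp_mpoly_id; congr (comp_mpoly _ _).
apply: eq_from_tnth => i; rewrite !tnth_mktuple (bigD1 i) //= mxE eqxx scale1r.
by rewrite big1 ?addr0 //= => j ne; rewrite mxE eq_sym (negPf ne) scale0r.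
Qed.

Lemma linear_changeZ M (c : K) f :
  linear_change M (c *: f) = c *: linear_change M f.
Proof. exact: comp_mpolyZ. Qed.

Lemma projectively_equivalent_refl f : projectively_equivalent f f.
Proof.
by exists 1%:M, 1; rewrite unitmx1 oner_neq0 linear_change1 scale1r.
Qed.

Lemma projectively_equivalent_scale (c : K) f :
  c != 0 -> projectively_equivalent f (c *: f).
Proof.
move=> c0; exists 1%:M, c^-1.
by rewrite unitmx1 invr_eq0 c0 linear_change1 scalerA mulVf ?scale1r.
Qed.

Lemma projectively_equivalent_sym f g :
  projectively_equivalent f g -> projectively_equivalent g f.
Proof.
move=> [M [c [uM c0 e]]]; exists (invmx M), c^-1.
rewrite unitmx_inv uM invr_eq0 c0; split=> //.
by rewrite -[g]scale1r -(mulVf c0) -scalerA linear_changeZ -e linear_changeM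
  mulmxV // linear_change1.
Qed.

Lemma projectively_equivalent_trans f g h : projectively_equivalent f g ->
  projectively_equivalent g h -> projectively_equivalent f h.
Proof.
move=> [M [c [uM c0 e]]] [N [d [uN d0 e']]]; exists (M *m N), (c * d).
rewrite unitmx_mul uM uN mulf_neq0 //; split=> //.
by rewrite -linear_changeM e linear_changeZ e' scalerA.
Qed.

Lemma meval_linear_change M f (v : 'cV[K]_n) :
  (linear_change M f).@[v^~ 0] = f.@[(M *m v)^~ 0].
Proof.
rewrite /linear_change comp_mpoly_meval; apply: meval_eq => i.
rewrite tnth_mktuple raddf_sum mxE /=.
by apply: eq_bigr => j _; rewrite mevalZ mevalXU.
Qed.

End Equivalence.

(** * The normal form *)

Local Notation i0 := (@Ordinal 4 0 isT).
Local Notation i1 := (@Ordinal 4 1 isT).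
Local Notation i2 := (@Ordinal 4 2 isT).
Local Notation i3 := (@Ordinal 4 3 isT).

Lemma sum4 (V : nmodType) (F : 'I_4 -> V) :
  \sum_i F i = F i0 + F i1 + F i2 + F i3.
Proof.
rewrite !big_ord_recl big_ord0 addr0 !addrA.
by congr (F _ + F _ + F _ + F _); apply: val_inj.
Qed.

(** The same expression is used for the polynomial, for its values, and for its
    images under substitutions; hence the general ring. *)
Definition normal_form (R : comNzRingType) (w k x y s t : R) : R :=
  let z := w * s - x - y in
  t * (x * y * z - k * s ^+ 3) + s * ((y - z) * (z - x) * (x - y)).

Lemma rmorph_normal_form (R R' : comNzRingType) (phi : {rmorphism R -> R'})
    (w k x y s t : R) :
  phi (normal_form w k x y s t) =
  normal_form (phi w) (phi k) (phi x) (phi y) (phi s) (phi t).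
Proof. by rewrite /normal_form !(rmorphD, rmorphN, rmorphM, rmorphXn). Qed.

Definition normal_quartic (K : fieldType) (w k : K) : {mpoly K[4]} :=
  normal_form w%:MP k%:MP 'X_i0 'X_i1 'X_i2 'X_i3.

Lemma meval_normal_quartic (K : fieldType) (w k : K) v :
  (normal_quartic w k).@[v] = normal_form w k (v i0) (v i1) (v i2) (v i3).
Proof. by rewrite rmorph_normal_form /= !mevalC !mevalXU. Qed.

Lemma linear_change_normal_quartic (K : fieldType) (w k : K) (M : 'M[K]_4) :
  let L i := \sum_j M i j *: 'X_j in
  linear_change M (normal_quartic w k) =
  normal_form w%:MP k%:MP (L i0) (L i1) (L i2) (L i3).
Proof.
move=> L; rewrite [LHS]rmorph_normal_form /= !comp_mpolyC !comp_mpolyXU.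
by rewrite -!tnth_nth !tnth_mktuple.
Qed.

Definition param_w (K : fieldType) (a : K) : K := 2 * (a ^+ 2 - a + 1).

Definition param_k (K : fieldType) (a : K) : K := 2 * a ^+ 2 * (a - 1) ^+ 2.

(** For the cubic of Q(a), the flexes among the twelve points are (0:0:1),
    (1:0:0) and (1:0:-1).  Up to the factor a, the first three rows are the
    tangents at the first two of them and the line y = 0 that joins all three.
    The last row absorbs the multiple of the cubic by which the part of the
    quartic free of t differs from the product of that line and the harmonic
    polars.  The factor a keeps denominators away. *)
Definition normalization (K : fieldType) (a : K) : 'M[K]_4 :=
  let c := (2 * a - 1) * (a - 2) in
  \matrix_(i, j) nth 0 (nth [::]
    [:: [:: - (a * c);   a ^+ 2;         0;     0];
        [::         0;   a ^+ 2; - (a * c);     0];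
        [::         0;        a;         0;     0];
        [::   - 2 * c;  - 3 * c;   - 4 * c; 4 * c]] i) j.

Lemma linear_change_normal (K : fieldType) (a : K) :
  linear_change (normalization a) (normal_quartic (param_w a) (param_k a)) =
  (2 * a ^+ 3 * ((2 * a - 1) * (a - 2)) ^+ 3) *: quartic a.
Proof.
rewrite linear_change_normal_quartic !sum4 !mxE /quartic /=.
rewrite -!mul_mpolyC /normal_form /param_w /param_k.
ring.
Qed.

Lemma normalization_unit (K : fieldType) (a : K) :
  2 != 0 :> K -> a != 0 -> 2 * a - 1 != 0 -> a - 2 != 0 ->
  normalization a \in unitmx.
Proof.
move=> n2 a0 a1 a2; pose c := (2 * a - 1) * (a - 2).
have c0 : c != 0 by rewrite mulf_neq0.
have [] // := @mulmx1_unit _ _ (normalization a) (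
  \matrix_(i, j) nth 0 (nth [::]
    [:: [:: - (a * c)^-1; 0; c^-1; 0];
        [:: 0; 0; a^-1; 0];
        [:: 0; - (a * c)^-1; c^-1; 0];
        [:: - (2 * a * c)^-1; - (a * c)^-1;
            (c * 2)^-1 + c^-1 + 3 / (4 * a); (4 * c)^-1]] i) j).
apply/matrixP => i j; rewrite !mxE sum4 !mxE /= -/c; move: c c0 => c c0.
have n4 : 4 != 0 :> K by rewrite (_ : 4 = 2 * 2) ?mulf_neq0 //; ring.
case: i => [[|[|[|[|]]]] ?] //=; case: j => [[|[|[|[|]]]] ?] //=; field.
all: try by rewrite ?a0 ?c0 ?n2 ?n4.
Qed.

(** * Flexes of the cone *)

Section Geometry.
Variable K : fieldType.
Implicit Types (w k : K) (p u v : 'cV[K]_4) (i j : 'I_3).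

Lemma col4P u v : u i0 0 = v i0 0 -> u i1 0 = v i1 0 ->
  u i2 0 = v i2 0 -> u i3 0 = v i3 0 -> u = v.
Proof.
move=> e0 e1 e2 e3; apply/colP => -[[|[|[|[|//]]]] lt4];
  by rewrite (bool_irrelevance lt4 isT).
Qed.

(** With the known equation as first argument, this leaves an identity for
    ring. *)
Lemma eq_of_sub (x x' y y' : K) : x = x' -> y - y' = x - x' -> y = y'.
Proof. by move=> -> /eqP; rewrite subrr subr_eq0 => /eqP. Qed.

(** The forms x, y, z of the normal form.  Indexing them by a finite type lets
    a linear map permute them by an injection instead of by six cases. *)
Definition tangent w i v : K :=
  nth 0 [:: v i0 0; v i1 0; w * v i2 0 - v i0 0 - v i1 0] i.

Definition harmonic w i v : K :=
  let x := v i0 0 in let y := v i1 0 in let z := w * v i2 0 - x - y in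
  nth 0 [:: y - z; z - x; x - y] i.

(** The flex numbered i has s = 0 and i-th tangent form 0; the signs make the
    other two tangent forms equal to 1 and -1 in cyclic order. *)
Definition flex i : 'cV[K]_4 :=
  \col_j nth 0 (nth [::] [:: [:: 0; 1; 0; 0]; [:: - 1; 0; 0; 0];
                             [:: 1; - 1; 0; 0]] i) j.

Definition apex : 'cV[K]_4 := delta_mx i3 0.

Definition cone w k v : K := \prod_i tangent w i v - k * v i2 0 ^+ 3.

(** On the cone, its zeros are the lines of the surface through the apex. *)
Definition line_locus w v : K := v i2 0 * \prod_i harmonic w i v.

Definition surface w k v : K := v i3 0 * cone w k v + line_locus w v.

(** For a cubic form with associated symmetric trilinear form B this is
    6 B(p, p, v). *)
Definition polar (f : 'cV[K]_4 -> K) p v : K :=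
  f (p + v) - f (p - v) - 2 * f v.

(** On the line through p in a direction v tangent to f, the term of order two
    vanishes as well. *)
Definition is_flex (f : 'cV[K]_4 -> K) p : Prop :=
  forall v, polar f p v = 0 -> polar f v p = 0.

Ltac expand := rewrite /polar /is_flex /cone !big_ord_recl !big_ord0 /tangent
  /harmonic /flex /apex /= !mxE /=.

Lemma surfaceE w k v :
  surface w k v = normal_form w k (v i0 0) (v i1 0) (v i2 0) (v i3 0).
Proof.
rewrite /surface /cone /line_locus /normal_form !big_ord_recl !big_ord0.
by rewrite /tangent /harmonic /=; ring.
Qed.

Lemma surface_apex w k v (m : K) :
  surface w k (v + m *: apex) = surface w k v + m * cone w k v.
Proof. by rewrite /surface /line_locus; expand; ring. Qed.

Lemma polar_flex w k i v : polar (cone w k) (flex i) v = - 2 * tangent w i v.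
Proof. by case: i => [[|[|[|]]] ?] //; expand; ring. Qed.

Lemma polar_flex_apex w k i (l m : K) v :
  polar (cone w k) (l *: flex i + m *: apex) v = - 2 * l ^+ 2 * tangent w i v.
Proof. by case: i => [[|[|[|]]] ?] //; expand; ring. Qed.

(** The polar conic of a flex splits into its tangent and its harmonic polar. *)
Lemma polar_at_flex w k i v :
  polar (cone w k) v (flex i) = - 2 * (tangent w i v * harmonic w i v).
Proof. by case: i => [[|[|[|]]] ?] //; expand; ring. Qed.

Lemma flex_is_flex w k i : 2 != 0 :> K -> is_flex (cone w k) (flex i).
Proof.
move=> n2 v; rewrite polar_flex polar_at_flex => /eqP.
by rewrite mulf_eq0 oppr_eq0 (negPf n2) => /eqP ->; rewrite mul0r mulr0.
Qed.

Lemma cone_flex w k i : cone w k (flex i) = 0.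
Proof. by case: i => [[|[|[|]]] ?] //; expand; ring. Qed.

Lemma line_locus_flex w i : line_locus w (flex i) = 0.
Proof.
by case: i => [[|[|[|]]] ?] //; rewrite /line_locus /flex !mxE mul0r.
Qed.

Lemma tangent_flex w i j : (tangent w j (flex i) == 0) = (i == j).
Proof.
case: i => [[|[|[|]]] ?] //; case: j => [[|[|[|]]] ?] //;
  rewrite /tangent /flex /= !mxE /=;
  rewrite ?(mulr0, subr0, sub0r, opprK, oppr0, subrr, addNr, eqxx) //;
  by rewrite ?oppr_eq0 oner_eq0.
Qed.

Lemma tangent_neq0 w i : exists v, tangent w i v != 0.
Proof.
exists (if i == ord0 then delta_mx i0 0 else delta_mx i1 0).
case: i => [[|[|[|]]] ?] //=; rewrite /tangent /= !mxE //=.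
all: by rewrite ?mulr0 ?subr0 ?sub0r ?oppr_eq0 oner_eq0.
Qed.

(** A flex p on the i-th harmonic polar lies on the polar conic of the i-th
    flex, which means that this flex is a tangent direction at p.  As p is a
    flex, the i-th flex satisfies the second order condition too, which says
    that p is on the i-th tangent.  It meets the cone only on s = 0. *)
Lemma flex_on_line_locus w k p : 2 != 0 :> K -> k != 0 ->
  is_flex (cone w k) p -> cone w k p = 0 -> line_locus w p = 0 -> p i2 0 = 0.
Proof.
move=> n2 k0 fp cp /eqP; rewrite mulf_eq0 => /orP[/eqP //|].
rewrite prodf_seq_eq0 => /hasP [i _ /andP [_ /eqP hi]].
have /fp/eqP : polar (cone w k) p (flex i) = 0.
  by rewrite polar_at_flex hi !mulr0.
rewrite polar_flex mulf_eq0 oppr_eq0 (negPf n2) => /eqP ti.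
move/eqP: cp; rewrite /cone (bigD1 i) //= ti mul0r sub0r oppr_eq0 mulf_eq0.
by rewrite (negPf k0) expf_eq0 => /eqP.
Qed.

Lemma cone_infinity w k p : cone w k p = 0 -> p i2 0 = 0 ->
  exists i l m, p = l *: flex i + m *: apex.
Proof.
rewrite /cone => /[swap] p2; rewrite p2 expr0n mulr0 subr0 => /eqP.
rewrite prodf_seq_eq0 => /hasP [i _ /andP [_ /eqP ti]].
exists i, (nth 0 [:: p i1 0; - p i0 0; p i0 0] i), (p i3 0).
apply: col4P; move: ti; case: i => [[|[|[|]]] ?] //;
  rewrite /tangent /flex /apex /= ?p2 !mxE /=;
  rewrite ?(mulr0, mulr1, addr0, add0r, mulrN, opprK) //.
by move/subr0_eq.
Qed.

(** A point where the cone is singular is on the line of the apex: its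
    coordinates satisfy y (z - x) = x (z - y) = 0 and w x y = 3 k s^2; if x or
    y is 0 then so are x, y and s, and otherwise x = y = z, 3 x = w s, so that
    w^3 = 27 k. *)
Lemma singular_cone w k p : 2 != 0 :> K -> 3 != 0 :> K -> k != 0 ->
  w ^+ 3 != 27 * k -> (forall v, polar (cone w k) p v = 0) ->
  p = p i3 0 *: apex.
Proof.
move=> n2 n3 k0 wk sing.
have px : p i1 0 * (w * p i2 0 - p i1 0 - 2 * p i0 0) = 0.
  by apply: (mulfI n2); rewrite mulr0 -(sing (delta_mx i0 0)); expand; ring.
have py : p i0 0 * (w * p i2 0 - p i0 0 - 2 * p i1 0) = 0.
  by apply: (mulfI n2); rewrite mulr0 -(sing (delta_mx i1 0)); expand; ring.
have pz : w * p i0 0 * p i1 0 - 3 * k * p i2 0 ^+ 2 = 0.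
  by apply: (mulfI n2); rewrite mulr0 -(sing (delta_mx i2 0)); expand; ring.
have s0 : p i0 0 * p i1 0 = 0 -> p i2 0 = 0.
  move=> xy0; move/eqP: pz; rewrite -mulrA xy0 mulr0 sub0r oppr_eq0.
  by rewrite !mulf_eq0 (negPf n3) (negPf k0) /= orbb => /eqP.
have x0 : p i0 0 = 0.
  apply: contraNeq wk => x0.
  have [y0|y0] := eqVneq (p i1 0) 0.
    move/eqP: py; rewrite s0 y0 ?mulr0 // sub0r subr0 mulrN oppr_eq0.
    by rewrite mulf_eq0 orbb (negPf x0).
  have ex : w * p i2 0 - p i1 0 - 2 * p i0 0 = 0.
    by apply: (mulfI y0); rewrite mulr0.
  have ey : w * p i2 0 - p i0 0 - 2 * p i1 0 = 0.
    by apply: (mulfI x0); rewrite mulr0.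
  have xy : p i1 0 = p i0 0 by apply: (eq_of_sub (etrans ex (esym ey))); ring.
  rewrite xy in ex pz.
  rewrite -subr_eq0 -(mulrI_eq0 _ (lregP (expf_neq0 2 x0))); apply/eqP.
  transitivity (w ^+ 2 * (w * p i0 0 * p i0 0 - 3 * k * p i2 0 ^+ 2) +
    3 * k * (w * p i2 0 + 3 * p i0 0) * (w * p i2 0 - p i0 0 - 2 * p i0 0)).
    by ring.
  by rewrite ex pz !mulr0 addr0.
have y0 : p i1 0 = 0.
  move/eqP: px; rewrite s0 x0 ?mul0r // !mulr0 sub0r subr0 mulrN oppr_eq0.
  by rewrite mulf_eq0 orbb => /eqP.
by apply: col4P; rewrite ?s0 ?x0 ?y0 ?mul0r // !mxE /= ?mulr0 ?mulr1.
Qed.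

(** * Equivalences of normal forms *)

Section Transport.
Variables (w k w' k' c : K) (M : 'M[K]_4).
Hypotheses (n2 : 2 != 0 :> K) (n3 : 3 != 0 :> K) (k0 : k != 0) (k0' : k' != 0).
Hypotheses (wk : w ^+ 3 != 27 * k) (c0 : c != 0) (uM : M \in unitmx).
Hypothesis MF : forall v, surface w k (M *m v) = c * surface w' k' v.

(** In the direction of the apex the second surface is affine, so in the
    direction p of its image the first surface is affine; hence so is the cone,
    the difference of the surface in the direction of the apex.  Then the second
    difference of the cone, which is its polar at p, vanishes: p is a singular
    point of the cone. *)
Lemma transport_apex : exists2 m, m != 0 & M *m apex = m *: apex.
Proof.
pose p := M *m apex.
have affine v : surface w k (v + p) + surface w k (v - p) = 2 * surface w k v.
  rewrite -[v](mulKVmx uM) -mulmxDr -mulmxBr !MF -[apex]scale1r -scaleNr.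
  by rewrite !surface_apex; ring.
have sing v : polar (cone w k) p v = 0.
  pose u := v + 1 *: apex.
  transitivity (surface w k (u + p) + surface w k (u - p) - 2 * surface w k u -
    (surface w k (v + p) + surface w k (v - p) - 2 * surface w k v)).
    rewrite /u ![v + 1 *: apex + _]addrAC !surface_apex; expand; ring.
  by rewrite !affine; ring.
exists (p i3 0); last exact: singular_cone sing.
apply/eqP => p30; have := singular_cone n2 n3 k0 wk sing.
rewrite p30 scale0r => /(congr1 (mulmx (invmx M))); rewrite mulKmx // mulmx0.
by move/colP/(_ i3)/eqP; rewrite !mxE eqxx oner_eq0.
Qed.

Lemma transport_cone :
  exists2 g, g != 0 & forall v, cone w k (M *m v) = g * cone w' k' v.
Proof.
have [m m0 Mapex] := transport_apex.
exists (c / m) => [|v]; first by rewrite mulf_neq0 ?invr_eq0.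
have := MF (v + 1 *: apex); rewrite mulmxDr -scalemxAr Mapex scalerA mul1r.
rewrite !surface_apex MF mul1r (mulrDr c (surface _ _ _)) => /addrI e.
by apply: (mulfI m0); rewrite e; field.
Qed.

Lemma transport_line_locus v :
  cone w' k' v = 0 -> line_locus w' v = 0 -> line_locus w (M *m v) = 0.
Proof.
have [g _ Mcone] := transport_cone.
move=> cv sv; have := MF v; rewrite /surface Mcone cv sv.
by rewrite !mulr0 !add0r mulr0.
Qed.

(** The image of a flex is a flex in the line locus, so it is one of the flexes
    up to a factor and a multiple of the apex; the tangent at a flex is its
    polar and therefore goes along. *)
Lemma transport_flex i : (M *m flex i) i2 0 = 0 /\
  exists jl : 'I_3 * K, jl.2 != 0 /\
    forall v, tangent w jl.1 (M *m v) = jl.2 * tangent w' i v.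
Proof.
have [g g0 Mcone] := transport_cone.
have Mpolar p v :
    polar (cone w k) (M *m p) (M *m v) = g * polar (cone w' k') p v.
  by rewrite /polar -mulmxDr -mulmxBr !Mcone; ring.
have Mflex : is_flex (cone w k) (M *m flex i).
  move=> v; rewrite -[v](mulKVmx uM) !Mpolar => /eqP.
  by rewrite mulf_eq0 (negPf g0) => /eqP /flex_is_flex -> //; exact: mulr0.
have Mi : cone w k (M *m flex i) = 0 by rewrite Mcone cone_flex mulr0.
have Mi2 : (M *m flex i) i2 0 = 0.
  apply: flex_on_line_locus Mi _ => //.
  by rewrite transport_line_locus ?cone_flex ?line_locus_flex.
split=> //; have [j [l [m e]]] := cone_infinity Mi Mi2.
have tang v : l ^+ 2 * tangent w j (M *m v) = g * tangent w' i v.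
  have n2' : - 2 != 0 :> K by rewrite oppr_eq0.
  apply: (mulfI n2'); have := Mpolar (flex i) v.
  rewrite e polar_flex_apex polar_flex => e'.
  by rewrite mulrA e'; ring.
have l0 : l != 0.
  have [v tv] := tangent_neq0 w' i; apply: contraNneq tv => l0.
  by move/eqP: (tang v); rewrite l0 expr0n mul0r eq_sym mulf_eq0 (negPf g0).
exists (j, g / l ^+ 2); split=> /= [|v].
  by rewrite mulf_neq0 ?invr_eq0 ?expf_neq0.
by apply: (mulfI (expf_neq0 2 l0)); rewrite tang; field.
Qed.

(** The tangents x, y, z are permuted with factors mu, and s is multiplied by
    nu.  The relation x + y + z = w' s forces the factors to be equal, to m
    say, with m w' = w nu; the equation of the cone gives k nu^3 = m^3 k'. *)
Lemma transport_invariant : w ^+ 3 * k' = w' ^+ 3 * k.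
Proof.
have [g g0 Mcone] := transport_cone.
have /fin_all_exists [jl jlP] := fun i => (transport_flex i).2.
pose s i := (jl i).1; pose mu i := (jl i).2.
have mu0 i : mu i != 0 by have [] := jlP i.
have Mtan i v : tangent w (s i) (M *m v) = mu i * tangent w' i v.
  by have [_] := jlP i.
have sI : injective s.
  move=> i j sij; apply/eqP; rewrite -(tangent_flex w').
  rewrite -(mulrI_eq0 _ (lregP (mu0 j))) -Mtan -sij Mtan.
  by rewrite (eqP (_ : tangent w' i (flex i) == 0)) ?mulr0 // tangent_flex.
have Mprod v : \prod_i tangent w i (M *m v) =
    \prod_i mu i * \prod_i tangent w' i v.
  rewrite (reindex_inj sI) -big_split /=.
  by apply: eq_bigr => i _; rewrite Mtan.
have sum_tangent a v : \sum_i tangent a i v = a * v i2 0.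
  by rewrite !big_ord_recl big_ord0 /tangent /=; ring.
pose e2 : 'cV[K]_4 := delta_mx i2 0; pose nu := (M *m e2) i2 0.
have Minf v : (M *m v) i2 0 = nu * v i2 0.
  have [m _ Mapex] := transport_apex.
  have [f0 _] := transport_flex ord0.
  have [f1 _] := transport_flex (lift ord0 ord0).
  have dec : v = v i1 0 *: flex ord0 - v i0 0 *: flex (lift ord0 ord0)
      + v i2 0 *: e2 + v i3 0 *: apex.
    by apply: col4P; rewrite /e2 /flex /apex !mxE /=; ring.
  rewrite {1}dec !mulmxDr mulmxN -!scalemxAr Mapex.
  have addE (x y : 'cV[K]_4) r : (x + y) r 0 = x r 0 + y r 0 by rewrite mxE.
  have oppE (x : 'cV[K]_4) r : (- x) r 0 = - x r 0 by rewrite mxE.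
  have scaleE a (x : 'cV[K]_4) r : (a *: x) r 0 = a * x r 0 by rewrite mxE.
  by rewrite !(addE, oppE, scaleE) f0 f1 -/nu /apex mxE /=; ring.
have Msum v : \sum_i mu i * tangent w' i v = w * nu * v i2 0.
  rewrite -mulrA -Minf -sum_tangent [RHS](reindex_inj sI) /=.
  by apply: eq_bigr => i _; rewrite Mtan.
have mu12 : mu (lift ord0 ord0) = mu (lift ord0 (lift ord0 ord0)).
  have := Msum (flex ord0).
  rewrite !big_ord_recl big_ord0 /tangent /flex /= !mxE /= => e.
  by apply: (eq_of_sub e); ring.
have mu02 : mu ord0 = mu (lift ord0 (lift ord0 ord0)).
  have := Msum (flex (lift ord0 ord0)).
  rewrite !big_ord_recl big_ord0 /tangent /flex /= !mxE /= => e.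
  by apply: (eq_of_sub (esym e)); ring.
pose m := mu ord0.
have mw : m * w' = w * nu.
  have := Msum e2; rewrite !big_ord_recl big_ord0 /tangent /= !mxE /= => e.
  by apply: (eq_of_sub e); rewrite mu12 -mu02 -/m; ring.
have gm : g = m ^+ 3.
  (* s = 0 and x y z = -2 at this vector *)
  pose v : 'cV[K]_4 := delta_mx i0 0 + delta_mx i1 0.
  have := Mcone v; rewrite /cone Mprod Minf.
  rewrite !big_ord_recl !big_ord0 /tangent /= !mxE /= => e; apply: (mulfI n2).
  by apply: (eq_of_sub e); rewrite mu12 -mu02 -/m; ring.
have kn : k * nu ^+ 3 = m ^+ 3 * k'.
  have := Mcone e2; rewrite /cone Mprod Minf gm.
  rewrite !big_ord_recl !big_ord0 /tangent /= !mxE /= => e.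
  by apply: (eq_of_sub (esym e)); ring.
have n0 : nu ^+ 3 != 0.
  have : k * nu ^+ 3 != 0 by rewrite kn -gm mulf_neq0.
  by rewrite mulf_eq0 => /norP [].
apply: (mulIf n0).
transitivity ((w * nu) ^+ 3 * k'); first by ring.
by rewrite -mw -[in RHS]mulrA kn; ring.
Qed.

End Transport.
End Geometry.

(** * The six values of the parameter *)

Section SixValues.
Variable K : fieldType.
Hypotheses (n2 : 2 != 0 :> K) (n3 : 3 != 0 :> K).
Implicit Types a b : K.

(** Clearing the denominator of 1/2 makes the condition visibly stable under
    a -> 1 - a and a -> 1/a. *)
Definition admissible a :=
  [&& a + 1 != 0, a != 0, 2 * a - 1 != 0, a - 1 != 0 & a - 2 != 0].

Lemma admissibleE a : (a \notin [:: -1; 0; 1 / 2; 1; 2]) = admissible a.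
Proof.
have e : (a == 1 / 2) = (2 * a - 1 == 0).
  by rewrite subr_eq0 -(inj_eq (mulfI n2) a) mulrCA mulfV // mulr1.
rewrite !inE !negb_or e /admissible -[a == 1]subr_eq0 -[a == 2]subr_eq0.
by rewrite -[a == -1]subr_eq0 opprK.
Qed.

Lemma admissible_1sub a : admissible a -> admissible (1 - a).
Proof.
case/and5P => a1 a2 a3 a4 a5; apply/and5P; split.
- by rewrite (_ : _ + 1 = - (a - 2)) ?oppr_eq0 //; ring.
- by rewrite -oppr_eq0 opprB.
- by rewrite (_ : _ - 1 = - (2 * a - 1)) ?oppr_eq0 //; ring.
- by rewrite (_ : _ - 1 = - a) ?oppr_eq0 //; ring.
- by rewrite (_ : _ - 2 = - (a + 1)) ?oppr_eq0 //; ring.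
Qed.

Lemma admissibleV a : admissible a -> admissible a^-1.
Proof.
case/and5P => a1 a2 a3 a4 a5; have aV : a^-1 != 0 by rewrite invr_eq0.
apply/and5P; split=> //.
- by rewrite (_ : _ + 1 = (a + 1) / a) ?mulf_neq0 //; field.
- by rewrite (_ : _ - 1 = - (a - 2) / a) ?mulf_neq0 ?oppr_eq0 //; field.
- by rewrite (_ : _ - 1 = - (a - 1) / a) ?mulf_neq0 ?oppr_eq0 //; field.
- by rewrite (_ : _ - 2 = - (2 * a - 1) / a) ?mulf_neq0 ?oppr_eq0 //; field.
Qed.

Lemma equivalent_normal a : admissible a ->
  projectively_equivalent (normal_quartic (param_w a) (param_k a)) (quartic a).
Proof.
case/and5P => _ a0 a3 _ a5; exists (normalization a).
exists (2 * a ^+ 3 * ((2 * a - 1) * (a - 2)) ^+ 3).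
by rewrite normalization_unit // linear_change_normal !mulf_neq0 ?expf_neq0.
Qed.

Lemma equivalent_1sub a : admissible a ->
  projectively_equivalent (quartic (1 - a)) (quartic a).
Proof.
move=> ada; have := equivalent_normal (admissible_1sub ada).
have -> : param_w (1 - a) = param_w a by rewrite /param_w; ring.
have -> : param_k (1 - a) = param_k a by rewrite /param_k; ring.
move=> /projectively_equivalent_sym /projectively_equivalent_trans; apply.
exact: equivalent_normal.
Qed.

Lemma quarticV a : a != 0 -> quartic a^-1 = a ^- 2 *: quartic a.
Proof.
move=> a0; rewrite /quartic -!mul_mpolyC -exprVn.
have e : a%:MP_[4] * a^-1%:MP = 1 by rewrite -mpolyCM mulfV.
by ring: e.
Qed.

Lemma equivalentV a : admissible a ->
  projectively_equivalent (quartic a^-1) (quartic a).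
Proof.
case/and5P => _ a0 _ _ _; rewrite quarticV //.
apply/projectively_equivalent_sym/projectively_equivalent_scale.
by rewrite invr_eq0 expf_neq0.
Qed.

Lemma equivalent_six_values a b : admissible b ->
  a \in [:: b; 1 / b; 1 / (1 - b); b / (b - 1); 1 - b; (b - 1) / b] ->
  projectively_equivalent (quartic a) (quartic b).
Proof.
move=> adb; have adb' := admissible_1sub adb.
have b0 : b != 0 by case/and5P: adb.
have b1 : 1 - b != 0 by case/and5P: adb'.
have b1' : b - 1 != 0 by case/and5P: adb.
have to_1sub := projectively_equivalent_trans (equivalentV adb')
  (equivalent_1sub adb).
rewrite !inE !div1r.
case/or4P=> [/eqP->|/eqP->|/eqP->|/or3P[]/eqP->] //; last 1 first.
- have -> : (b - 1) / b = 1 - b^-1 by field.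
  apply: projectively_equivalent_trans (equivalentV adb).
  exact/equivalent_1sub/admissibleV.
- exact: projectively_equivalent_refl.
- exact: equivalentV.
- have -> : b / (b - 1) = 1 - (1 - b)^-1 by field; rewrite b1' b1.
  apply: projectively_equivalent_trans to_1sub.
  exact/equivalent_1sub/admissibleV.
- exact: equivalent_1sub.
Qed.

(** The hypothesis is the equation j(a) = j(b) of Legendre parameters.  It has
    degree 6 in a and splits into linear factors, one for each value. *)
Lemma six_values a b : admissible b ->
  param_w a ^+ 3 * param_k b = param_w b ^+ 3 * param_k a ->
  a \in [:: b; 1 / b; 1 / (1 - b); b / (b - 1); 1 - b; (b - 1) / b].
Proof.
move=> /and5P [_ b0 _ b1 _] e.
have b1' : 1 - b != 0 by rewrite -opprB oppr_eq0.
have /eqP : 2 ^+ 4 * ((a - b) * (a * b - 1) * (a * (1 - b) - 1)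
    * (a * (b - 1) - b) * (a - (1 - b)) * (a * b - (b - 1))) = 0.
  by apply: (eq_of_sub (esym e)); rewrite /param_w /param_k; ring.
rewrite mulf_eq0 expf_eq0 (negPf n2) /= !mulf_eq0 !subr_eq0 -!orbA.
have root x y : y != 0 -> a * y = x -> a = x / y by move=> y0 <-; rewrite mulfK.
rewrite !inE.
case/or4P=> [-> //|/eqP/root->|/eqP/root->|/or3P[/eqP/root->|->|]] //;
  rewrite ?eqxx ?orbT //.
by move/eqP/root => -> //; rewrite eqxx !orbT.
Qed.

Lemma smooth_cone a : admissible a -> param_w a ^+ 3 != 27 * param_k a.
Proof.
case/and5P => a1 _ a3 _ a5; rewrite -subr_eq0.
have -> : param_w a ^+ 3 - 27 * param_k a =
    2 * ((a + 1) * (2 * a - 1) * (a - 2)) ^+ 2.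
  by rewrite /param_w /param_k; ring.
by rewrite !(mulf_neq0, expf_neq0).
Qed.

Lemma param_k_neq0 a : admissible a -> param_k a != 0.
Proof.
by case/and5P => _ a0 _ a1 _; rewrite /param_k !mulf_neq0 ?expf_neq0.
Qed.

Lemma equivalent_param a b : admissible a -> admissible b ->
  projectively_equivalent (quartic a) (quartic b) ->
  param_w a ^+ 3 * param_k b = param_w b ^+ 3 * param_k a.
Proof.
move=> ada adb eab.
have := projectively_equivalent_trans (equivalent_normal ada)
  (projectively_equivalent_trans eab
    (projectively_equivalent_sym (equivalent_normal adb))).
case=> M [c [uM c0 e]].
apply: (transport_invariant n2 n3 _ _ _ c0 uM) => [||| v].
- exact: param_k_neq0.
- exact: param_k_neq0.
- exact: smooth_cone.
- move/(congr1 (meval (v^~ 0))): e; rewrite meval_linear_change mevalZ.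
  by rewrite !meval_normal_quartic -!surfaceE.
Qed.

End SixValues.

Theorem theorem10 (K : fieldType) (charK : [pchar K] =i pred0) (a b : K)
    (ha : a \notin [:: -1; 0; 1 / 2; 1; 2])
    (hb : b \notin [:: -1; 0; 1 / 2; 1; 2]) :
  projectively_equivalent (quartic a) (quartic b) <->
  a \in [:: b; 1 / b; 1 / (1 - b); b / (b - 1); 1 - b; (b - 1) / b].
Proof.
have /pcharf0P char0 := charK.
have n2 : 2 != 0 :> K by rewrite char0.
have n3 : 3 != 0 :> K by rewrite char0.
rewrite !admissibleE // in ha hb; split; last exact: equivalent_six_values.
by move/(equivalent_param n2 n3 ha hb)/(six_values n2 hb).
Qed.
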